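(* Let $D$ and $D'$ be two documents that differ only in that, at any number of nodes, the collection of inheritance references written at that node is permuted and/or deduplicated (the definitions at every node being the same). Then $D$ and $D'$ have the same semantics, i.e. the five semantic functions $\mathrm{supers},\mathrm{overrides},\mathrm{bases},\mathrm{resolve},\mathrm{this}$ of $D$ and of $D'$ coincide. In particular, for paths $p_1,p_2$ pointing to mixins named in a common enclosing scope, a mixin with member references $[p_1],[p_2]$ and a mixin with member references $[p_2],[p_1]$ yield the same document (the same $\mathrm{inherits}$, hence the same semantics), and a mixin with member references $[p_1],[p_1]$ and one with the single member reference $[p_1]$ yield the same document.
   Context: **Documents.** A node is a scalar (a tag and a string), a sequence (a tag and a finite list of nodes) or a mapping (a tag and a finite list of pairs of nodes). The relevant tags are !!seq, !!map, !!str, !!null. A program (document) is a finite node $\mathrm{doc}$ (a YAML document without anchors). Labels are strings; a path is a finite sequence of labels; $()$ is the root path; $p\triangleright\ell$ appends a label; $p\frown w$ concatenates a label sequence; for $p\ne()$, $\mathrm{init}(p)$ drops the last label and $\mathrm{last}(p)$ is the last label (both undefined at $()$). Set comprehensions silently omit terms in which a partial function is undefined, and are empty if their source is undefined. **Surface form.** A mixin body is a !!seq sequence of members; a member is either a reference (a !!seq sequence of scalars, written $[\ell_1,\dots,\ell_k]$; $[p]$ for a path $p$ lists the labels of $p$) or a definition (a single-pair !!map mapping $\ell: m$ from a !!str scalar $\ell$ to a mixin body $m$). **Syntactic helpers.** $\mathrm{items}(\mathit{node})$ is the list of children if $\mathit{node}$ is a !!seq sequence (undefined otherwise). $\mathrm{kv}(\mathit{node})=(\ell,m)$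 if $\mathit{node}$ is a !!map mapping with exactly one pair, whose key is a !!str scalar with content $\ell$ and whose value is $m$ (undefined otherwise). $\mathrm{at}(())=\mathrm{doc}$; $\mathrm{at}(p\triangleright\ell)$ is the unique $m$ with $(\ell,m)=\mathrm{kv}(\mathit{node})$ for some $\mathit{node}\in\mathrm{items}(\mathrm{at}(p))$. $\mathrm{has}(p,\ell)$ holds iff some $\mathit{node}\in\mathrm{items}(\mathrm{at}(p))$ has $\mathrm{kv}(\mathit{node})=(\ell,\_)$. $\mathrm{lexical}(p,\ell)=0$ if $\mathrm{has}(p,\ell)$, else $1+\mathrm{lexical}(\mathrm{init}(p),\ell)$. $\mathrm{qualified}(p,\ell)=0$ if $\mathrm{last}(p)=\ell$, else $1+\mathrm{qualified}(\mathrm{init}(p),\ell)$. For a list of scalars $r=(s_1,\dots,s_k)$: if $s_2$ is !!null, $\mathrm{indexed}(p,r)=(\mathrm{qualified}(\mathrm{init}(p),s_1),(s_3,\dots,s_k))$; otherwise $\mathrm{indexed}(p,r)=(\mathrm{lexical}(\mathrm{init}(p),s_1),(s_1,\dots,s_k))$ (scalars read as labels, requiring !!str). $\mathrm{dom}(\mathrm{inherits})=\{p: p=()\text{ or }\mathrm{has}(\mathrm{init}(p),\mathrm{last}(p))\}$, and for $p$ in it $\mathrm{inherits}(p)=\{\mathrm{indexed}(p,\mathrm{items}(r)) : r\in\mathrm{items}(\mathrm{at}(p))\}\subseteq\mathbb N\times\mathrm{Label}^*$. **Semantics.** The five functions are the least solution (pointwise inclusion; least fixed point of the associated monotone operator)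 of: - $\mathrm{supers}(())=\{((),())\}$; $\mathrm{supers}(p\triangleright\ell)=\{(\mathrm{init}(b),o): b\in\mathrm{bases}^*(p\triangleright\ell),\ o\in\mathrm{overrides}(b)\}$, with $\mathrm{bases}^*$ the reflexive-transitive closure; - $\mathrm{overrides}(())=\{()\}$; $\mathrm{overrides}(p\triangleright\ell)=\{o : (\_,b)\in\mathrm{supers}(p),\ b\triangleright\ell\in\mathrm{dom}(\mathrm{inherits}),\ o\in\{p\triangleright\ell,\,b\triangleright\ell\}\}$; - $\mathrm{bases}(())=\varnothing$; $\mathrm{bases}(p\triangleright\ell)=\{t : o\in\mathrm{overrides}(p\triangleright\ell),\ (n,w)\in\mathrm{inherits}(o),\ t\in\mathrm{resolve}(p,o,n,w)\}$; - $\mathrm{resolve}(s,d,n,w)=\{c\frown w : c\in\mathrm{this}(\{s\},\mathrm{init}(d),n)\}$; - $\mathrm{this}(S,d,0)=S$; for $n>0$, $\mathrm{this}(S,d,n)=\bigcup_{c\in S}\bigcup_{(t,d)\in\mathrm{supers}(c)}\mathrm{this}(\{t\},\mathrm{init}(d),n-1)$.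
   Formalization: If one mixin body writes the same definition several times, its copies must be permuted or deduplicated alike, and distinct definitions must stay distinct; otherwise the lookup of that label can become undefined and the claim fails. *)

(* Defs.v *)
From Stdlib Require Import String List Permutation Relations.Relation_Operators.
Import ListNotations.

(** * Documents *)

Inductive tag : Type :=
| TagSeq
| TagMap
| TagStr
| TagNull
| TagOther (s : string).

Inductive node : Type :=
| Scalar (t : tag) (s : string)
| Sequence (t : tag) (ns : list node)
| Mapping (t : tag) (ps : list (node * node)).

Definition label := string.
Definition path := list label.

Definition snoc (p : path) (l : label) : path := p ++ [l].
Infix "▷" := snoc (at level 60, no associativity).

Definition init (p : path) : option path :=
  match p with [] => None | _ => Some (removelast p) end.

(** * Surface form *)

Definition str (l : label) : node := Scalar TagStr l.
Definition body (members : list node) : node := Sequence TagSeq members.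
Definition def (l : label) (m : node) : node := Mapping TagMap [(str l, m)].
Definition ref (p : path) : node := Sequence TagSeq (map str p).

Definition is_scalar (n : node) : bool :=
  match n with Scalar _ _ => true | _ => false end.

Definition is_reference (n : node) : bool :=
  match n with Sequence TagSeq ns => forallb is_scalar ns | _ => false end.

(* In a mixin body, the members that are not references are its definitions.
   A document is an arbitrary node, so in general [non_references] also keeps
   the members that fit neither form. *)
Definition references (ms : list node) : list node := filter is_reference ms.
Definition non_references (ms : list node) : list node :=
  filter (fun n => negb (is_reference n)) ms.

(** * Syntactic helpers

    Partial functions are options when they only inspect a node, and functional
    relations when they depend on the whole document. *)

Definition items (n : node) : option (list node) :=
  match n with Sequence TagSeq ns => Some ns | _ => None end.

Definition kv (n : node) : option (label * node) :=
  match n with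
  | Mapping TagMap [(Scalar TagStr l, m)] => Some (l, m)
  | _ => None
  end.

Definition defines (n : node) (l : label) (m : node) : Prop :=
  exists ns x, items n = Some ns /\ In x ns /\ kv x = Some (l, m).

(* [unique (defines n l) m] asks for a unique body, not a unique occurrence:
   repeating a definition verbatim is harmless. *)
Inductive node_at (doc : node) : path -> node -> Prop :=
| node_at_root : node_at doc [] doc
| node_at_child p l n m :
    node_at doc p n -> unique (defines n l) m -> node_at doc (p ▷ l) m.

Definition has (doc : node) (p : path) (l : label) : Prop :=
  exists n m, node_at doc p n /\ defines n l m.

Inductive lexical (doc : node) : path -> label -> nat -> Prop :=
| lexical_here p l : has doc p l -> lexical doc p l 0
| lexical_up p l' l n :
    ~ has doc (p ▷ l') l -> lexical doc p l n -> lexical doc (p ▷ l') l (S n).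

Inductive qualified : path -> label -> nat -> Prop :=
| qualified_here p l : qualified (p ▷ l) l 0
| qualified_up p l' l n :
    l' <> l -> qualified p l n -> qualified (p ▷ l') l (S n).

(* The two cases exclude each other: in the second one every scalar, hence the
   second one if there is one, is a !!str. *)
Inductive indexed (doc : node) (p : path) : list node -> nat * list label -> Prop :=
| indexed_qualified q l c w n :
    init p = Some q -> qualified q l n ->
    indexed doc p (str l :: Scalar TagNull c :: map str w) (n, w)
| indexed_lexical q l w n :
    init p = Some q -> lexical doc q l n ->
    indexed doc p (map str (l :: w)) (n, l :: w).

Definition dom_inherits (doc : node) (p : path) : Prop :=
  p = [] \/ exists q l, p = q ▷ l /\ has doc q l.

Definition inherits (doc : node) (p : path) (nw : nat * list label) : Prop :=
  dom_inherits doc p /\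
  exists m ms r rs,
    node_at doc p m /\ items m = Some ms /\ In r ms /\
    items r = Some rs /\ indexed doc p rs nw.

(** * Semantics *)

Record interp : Type := Interp {
  supers : path -> path * path -> Prop;
  overrides : path -> path -> Prop;
  bases : path -> path -> Prop;
  resolve : path -> path -> nat -> list label -> path -> Prop;
  this : (path -> Prop) -> path -> nat -> path -> Prop
}.

Definition interp_le (X Y : interp) : Prop :=
  (forall p x, supers X p x -> supers Y p x) /\
  (forall p o, overrides X p o -> overrides Y p o) /\
  (forall p t, bases X p t -> bases Y p t) /\
  (forall s d n w t, resolve X s d n w t -> resolve Y s d n w t) /\
  (forall A d n t, this X A d n t -> this Y A d n t).

Definition interp_eq (X Y : interp) : Prop := interp_le X Y /\ interp_le Y X.

(* The right-hand sides of the five equations; none of these is recursive. *)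

Inductive supers_rhs (X : interp) : path -> path * path -> Prop :=
| supers_root : supers_rhs X [] ([], [])
| supers_child p l b i o :
    clos_refl_trans path (bases X) (p ▷ l) b ->
    init b = Some i -> overrides X b o ->
    supers_rhs X (p ▷ l) (i, o).

Inductive overrides_rhs (doc : node) (X : interp) : path -> path -> Prop :=
| overrides_root : overrides_rhs doc X [] []
| overrides_child p l i b o :
    supers X p (i, b) -> dom_inherits doc (b ▷ l) ->
    o = p ▷ l \/ o = b ▷ l ->
    overrides_rhs doc X (p ▷ l) o.

Inductive bases_rhs (doc : node) (X : interp) : path -> path -> Prop :=
| bases_child p l o n w t :
    overrides X (p ▷ l) o -> inherits doc o (n, w) -> resolve X p o n w t ->
    bases_rhs doc X (p ▷ l) t.

Inductive resolve_rhs (X : interp) :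
  path -> path -> nat -> list label -> path -> Prop :=
| resolve_this s d d' n w c :
    init d = Some d' -> this X (eq s) d' n c ->
    resolve_rhs X s d n w (c ++ w).

(* Only those pairs of [supers X c] count whose second component is [d]. *)
Inductive this_rhs (X : interp) : (path -> Prop) -> path -> nat -> path -> Prop :=
| this_zero (A : path -> Prop) d c : A c -> this_rhs X A d 0 c
| this_succ (A : path -> Prop) d d' n c t u :
    A c -> supers X c (t, d) -> init d = Some d' -> this X (eq t) d' n u ->
    this_rhs X A d (S n) u.

Definition step (doc : node) (X : interp) : interp :=
  {| supers := supers_rhs X;
     overrides := overrides_rhs doc X;
     bases := bases_rhs doc X;
     resolve := resolve_rhs X;
     this := this_rhs X |}.

Definition closed (doc : node) (X : interp) : Prop := interp_le (step doc X) X.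

(* The least fixed point of [step doc], as the intersection of all its
   pre-fixed points; see [semantics_fixed] and [semantics_least]. *)
Definition semantics (doc : node) : interp :=
  {| supers := fun p x => forall X, closed doc X -> supers X p x;
     overrides := fun p o => forall X, closed doc X -> overrides X p o;
     bases := fun p t => forall X, closed doc X -> bases X p t;
     resolve := fun s d n w t => forall X, closed doc X -> resolve X s d n w t;
     this := fun A d n t => forall X, closed doc X -> this X A d n t |}.

Lemma step_mono doc X Y : interp_le X Y -> interp_le (step doc X) (step doc Y).
Proof.
intros (Hs & Ho & Hb & Hr & Ht); repeat split; cbn.
- intros p x [|q l b i o Hb' Hi Hov]; [constructor|].
  apply supers_child with b; auto.
  clear Hi Hov; induction Hb';
    [apply rt_step; auto | apply rt_refl | eapply rt_trans; eauto].
- intros p o []; econstructor; eauto.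
- intros p t []; econstructor; eauto.
- intros s d n w t []; econstructor; eauto.
- intros A d n t []; [constructor | econstructor]; eauto.
Qed.

Lemma interp_le_trans X Y Z : interp_le X Y -> interp_le Y Z -> interp_le X Z.
Proof.
intros (? & ? & ? & ? & ?) (? & ? & ? & ? & ?); repeat split; eauto.
Qed.

Lemma semantics_least_closed doc X : closed doc X -> interp_le (semantics doc) X.
Proof. intros H; repeat split; cbn; intros; auto. Qed.

Lemma semantics_closed doc : closed doc (semantics doc).
Proof.
assert (H : forall X, closed doc X -> interp_le (step doc (semantics doc)) X).
{ intros X HX; eapply interp_le_trans; [|exact HX].
  now apply step_mono, semantics_least_closed. }
repeat split; intros; intros X HX; now apply H.
Qed.

Lemma semantics_fixed doc : interp_eq (step doc (semantics doc)) (semantics doc).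
Proof.
split; [apply semantics_closed|].
apply semantics_least_closed, step_mono, semantics_closed.
Qed.

Lemma semantics_least doc X :
  interp_eq (step doc X) X -> interp_le (semantics doc) X.
Proof. intros [H _]; now apply semantics_least_closed. Qed.

Definition same_semantics (doc doc' : node) : Prop :=
  interp_eq (semantics doc) (semantics doc').

Definition same_inherits (doc doc' : node) : Prop :=
  (forall p, dom_inherits doc p <-> dom_inherits doc' p) /\
  (forall p nw, inherits doc p nw <-> inherits doc' p nw).

(** * Rearranging references *)

Inductive rearranged : list node -> list node -> Prop :=
| rearranged_perm rs rs' : Permutation rs rs' -> rearranged rs rs'
| rearranged_dedup r rs : In r rs -> rearranged (r :: rs) rs
| rearranged_sym rs rs' : rearranged rs rs' -> rearranged rs' rs
| rearranged_trans rs1 rs2 rs3 :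
    rearranged rs1 rs2 -> rearranged rs2 rs3 -> rearranged rs1 rs3.

(* [zs] pairs up, in order, the definitions of the two bodies.  Its last
   condition says that a definition written several times in one body is
   rearranged alike at each occurrence.  Without it, equal definitions
   [l: m], [l: m] could become [l: m], [l: m'] with [m] and [m'] different, and
   [node_at] would no longer be defined at [l].  It is void for bodies whose
   labels are distinct. *)
Inductive differ_in_refs : node -> node -> Prop :=
| differ_refl n : differ_in_refs n n
| differ_body ms ms' (zs : list (node * node)) :
    rearranged (references ms) (references ms') ->
    non_references ms = map fst zs ->
    non_references ms' = map snd zs ->
    (forall x x', In (x, x') zs -> differ_member x x') ->
    (forall x x' y y', In (x, x') zs -> In (y, y') zs -> (x = y <-> x' = y')) ->
    differ_in_refs (body ms) (body ms')
with differ_member : node -> node -> Prop :=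
| differ_same x : differ_member x x
| differ_def l m m' : differ_in_refs m m' -> differ_member (def l m) (def l m').

(** * Changing one mixin *)

Fixpoint replace (q : path) (b n : node) : node :=
  match q with
  | [] => b
  | l :: q' =>
      match n with
      | Sequence TagSeq ms =>
          body (map (fun x =>
            match kv x with
            | Some (l', m) => if String.eqb l' l then def l (replace q' b m) else x
            | None => x
            end) ms)
      | _ => n
      end
  end.

(* The enclosing scopes of the mixin at [q] are the proper prefixes of [q]; a
   reference written there is named in the scope that defines its first label. *)
Definition named_in_common_scope (doc : node) (q : path) (ps : list path) : Prop :=
  exists e w, q = e ++ w /\ w <> [] /\
    forall p, In p ps -> exists l v, p = l :: v /\ has doc e l.

(* Main.v *)
(** The semantics depends on the document only through its [inherits] function.
    A child of a node is read off its definitions, so documents that differ in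
    references have, at each path, nodes that again differ in references; and
    [inherits] collects the references of a node into a set, where order and
    repetition are lost.  Replacing the body of a single mixin is a special case,
    because a definition that is looked up on the way to it is unique. *)

Require Import Defs.
From Stdlib Require Import String List Permutation.
Import ListNotations.

(* Bodies and members alternate in the relation, so its symmetry takes an induction principle for
   both predicates at once. *)
Scheme differ_in_refs_mut := Induction for differ_in_refs Sort Prop
  with differ_member_mut := Induction for differ_member Sort Prop.

(** * Dependence of the semantics on [inherits] alone *)

Lemma same_inherits_sym D D' : same_inherits D D' -> same_inherits D' D.
Proof. intros [Hd Hi]; split; intros; symmetry; auto. Qed.

(** The document enters [step] at two places only: [dom_inherits] in the clause for [overrides] and
    [inherits] in the clause for [bases]. *)
Lemma same_inherits_closed D D' X :
  same_inherits D D' -> closed D X -> closed D' X.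
Proof.
intros [Hd Hi] (Hs & Ho & Hb & Hr & Ht); repeat split; auto.
- intros p o H; apply Ho; cbn in *.
  destruct H as [|p l i b o Hsup Hdom Heq]; econstructor; eauto.
  now apply Hd.
- intros p t H; apply Hb; cbn in *.
  destruct H as [p l o n w t Hov Hinh Hres]; econstructor; eauto.
  now apply Hi.
Qed.

(** Each semantics is a pre-fixed point of the other document's operator, so leastness gives both
    inclusions. *)
Lemma same_inherits_semantics D D' : same_inherits D D' -> same_semantics D D'.
Proof.
intros H.
assert (Hle : forall E E', same_inherits E E' ->
                interp_le (semantics E) (semantics E')).
{ intros E E' HE; apply semantics_least_closed.
  apply same_inherits_closed with E'; [now apply same_inherits_sym|].
  apply semantics_closed. }
split; apply Hle; auto using same_inherits_sym.
Qed.

(** * References and definitions as members of a body *)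

Lemma rearranged_In rs rs' :
  rearranged rs rs' -> forall r, In r rs <-> In r rs'.
Proof.
induction 1 as [rs rs' HP | r0 rs H0 | rs rs' _ IH | rs1 rs2 rs3 _ IH1 _ IH2];
  intros r.
- split; apply Permutation_in; auto using Permutation_sym.
- cbn; split; [intros [<-|H]|]; auto.
- symmetry; apply IH.
- rewrite IH1; apply IH2.
Qed.

Lemma In_references r ms : In r (references ms) <-> In r ms /\ is_reference r = true.
Proof. apply filter_In. Qed.

Lemma In_def_non_references l m ms :
  In (def l m) (non_references ms) <-> In (def l m) ms.
Proof. unfold non_references; rewrite filter_In; cbn; tauto. Qed.

Lemma kv_def x l m : kv x = Some (l, m) -> x = def l m.
Proof.
destruct x as [| |[] [|[[[]| |] ?] []]]; cbn; try discriminate.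
now intros [= -> ->].
Qed.

Lemma defines_body ms l m : defines (body ms) l m <-> In (def l m) ms.
Proof.
split.
- intros (ns & x & [= <-] & Hx & Hk); now rewrite <- (kv_def _ _ _ Hk).
- intros H; exists ms, (def l m); auto.
Qed.

Lemma defines_is_body n l m : defines n l m -> exists ms, n = body ms.
Proof.
intros (ns & x & Hn & _); destruct n as [|[] ms|]; try discriminate.
now exists ms.
Qed.

(** * Transfer of lookups between documents that differ in references *)

(** Swapping the components of every pair in [zs] works because each condition on [zs] is itself
    symmetric. Thanks to this, later inclusions are proved in one direction only. *)
Lemma differ_in_refs_sym n n' : differ_in_refs n n' -> differ_in_refs n' n.
Proof.
apply (differ_in_refs_mut (fun n n' _ => differ_in_refs n' n)
         (fun x x' _ => differ_member x' x)); try (constructor; assumption).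
intros ms ms' zs Hr Hn Hn' _ IH Hu.
apply differ_body with (map (fun z => (snd z, fst z)) zs).
- now apply rearranged_sym.
- now rewrite map_map.
- now rewrite map_map.
- intros x x' Hx; apply in_map_iff in Hx as ([] & [= <- <-] & Hx); auto.
- intros x x' y y' Hx Hy.
  apply in_map_iff in Hx as ([] & [= <- <-] & Hx).
  apply in_map_iff in Hy as ([] & [= <- <-] & Hy).
  symmetry; now apply Hu.
Qed.

Lemma differ_member_def_l l m x' :
  differ_member (def l m) x' -> exists m', x' = def l m' /\ differ_in_refs m m'.
Proof.
intros H; inversion H; subst; eauto using differ_refl.
Qed.

Lemma differ_member_def_r l m' x :
  differ_member x (def l m') -> exists m, x = def l m /\ differ_in_refs m m'.
Proof.
intros H; inversion H; subst; eauto using differ_refl.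
Qed.

(** Serves [has], where the last label may be defined with several bodies; descending along a path
    uses the version with [unique] below. *)
Lemma differ_defines n n' l m :
  differ_in_refs n n' -> defines n l m ->
  exists m', defines n' l m' /\ differ_in_refs m m'.
Proof.
intros [?|ms ms' zs Hr Hn Hn' Hz Hu] Hd; [eauto using differ_refl|].
apply defines_body, In_def_non_references in Hd; rewrite Hn in Hd.
apply in_map_iff in Hd as ([x x'] & Hx & Hin); cbn in Hx; subst x.
destruct (differ_member_def_l _ _ _ (Hz _ _ Hin)) as (m' & -> & Hm).
exists m'; split; auto.
apply defines_body, In_def_non_references; rewrite Hn'.
now apply (in_map snd) in Hin.
Qed.

Lemma differ_unique_defines n n' l m :
  differ_in_refs n n' -> unique (defines n l) m ->
  exists m', unique (defines n' l) m' /\ differ_in_refs m m'.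
Proof.
intros [?|ms ms' zs Hr Hn Hn' Hz Hu] [Hd Huniq];
  [exists m; split; [now split|constructor]|].
assert (Hdef := Hd).
apply defines_body, In_def_non_references in Hd; rewrite Hn in Hd.
apply in_map_iff in Hd as ([x x'] & Hx & Hin); cbn in Hx; subst x.
destruct (differ_member_def_l _ _ _ (Hz _ _ Hin)) as (m' & -> & Hm).
exists m'; split; auto; split.
- apply defines_body, In_def_non_references; rewrite Hn'.
  now apply (in_map snd) in Hin.
- intros m2 H2.
  apply defines_body, In_def_non_references in H2; rewrite Hn' in H2.
  apply in_map_iff in H2 as ([y y'] & Hy & Hin2); cbn in Hy; subst y'.
  destruct (differ_member_def_r _ _ _ (Hz _ _ Hin2)) as (m3 & -> & _).
  (* The competing definition in [ms'] is paired with one of the same label in [ms], where the body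
     is unique. Both pairs thus start from [def l m], and the last condition on [zs] identifies
     their second components. *)
  assert (m = m3) as <-.
  { apply Huniq, defines_body, In_def_non_references; rewrite Hn.
    now apply (in_map fst) in Hin2. }
  assert (E := proj1 (Hu _ _ _ _ Hin Hin2) eq_refl).
  now injection E.
Qed.

Lemma differ_references n n' ms :
  differ_in_refs n n' -> items n = Some ms ->
  exists ms', items n' = Some ms' /\
    forall r, is_reference r = true -> In r ms -> In r ms'.
Proof.
intros [?|ms0 ms' zs Hr _ _ _ _] H; [eauto|].
injection H as <-; exists ms'; split; auto.
intros r Hir Hin.
apply (In_references r ms'), (rearranged_In _ _ Hr), In_references; auto.
Qed.

Lemma differ_node_at D D' p n :
  differ_in_refs D D' -> node_at D p n ->
  exists n', node_at D' p n' /\ differ_in_refs n n'.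
Proof.
intros HD; induction 1 as [|p l n m _ (n' & Hn' & Hd) Hu].
- eauto using node_at_root.
- destruct (differ_unique_defines _ _ _ _ Hd Hu) as (m' & Hm' & Hdm).
  eauto using node_at_child.
Qed.

Lemma differ_has D D' p l : differ_in_refs D D' -> has D p l -> has D' p l.
Proof.
intros HD (n & m & Hn & Hm).
destruct (differ_node_at _ _ _ _ HD Hn) as (n' & Hn' & Hd).
destruct (differ_defines _ _ _ _ Hd Hm) as (m' & Hm' & _).
now exists n', m'.
Qed.

(** Symmetry is used for [lexical_up]: its negated [has] has to be carried from [D'] back to [D]. *)
Lemma differ_lexical D D' p l n :
  differ_in_refs D D' -> lexical D p l n -> lexical D' p l n.
Proof.
intros HD; induction 1; constructor; eauto using differ_has, differ_in_refs_sym.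
Qed.

Lemma differ_indexed D D' p rs nw :
  differ_in_refs D D' -> indexed D p rs nw -> indexed D' p rs nw.
Proof. intros HD []; econstructor; eauto using differ_lexical. Qed.

(** [inherits] ranges over all members, even nested sequences that are no references; but [indexed]
    accepts lists of scalars only, so every contributing member is among those that
    [differ_references] preserves. *)
Lemma indexed_is_reference D p r rs nw :
  items r = Some rs -> indexed D p rs nw -> is_reference r = true.
Proof.
assert (Hmap : forall w, forallb is_scalar (map str w) = true)
  by (induction w; auto).
destruct r as [|[]|]; try discriminate; intros [= ->] []; cbn; apply Hmap.
Qed.

Lemma differ_dom_inherits D D' p :
  differ_in_refs D D' -> dom_inherits D p -> dom_inherits D' p.
Proof.
intros HD [->|(q & l & -> & H)]; [now left|right].
eauto using differ_has.
Qed.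

Lemma differ_inherits D D' p nw :
  differ_in_refs D D' -> inherits D p nw -> inherits D' p nw.
Proof.
intros HD [Hdom (m & ms & r & rs & Hm & Hms & Hr & Hrs & Hi)].
split; [now apply differ_dom_inherits with D|].
destruct (differ_node_at _ _ _ _ HD Hm) as (m' & Hm' & Hd).
destruct (differ_references _ _ _ Hd Hms) as (ms' & Hms' & Hin).
exists m', ms', r, rs; repeat split; auto.
- eauto using indexed_is_reference.
- eauto using differ_indexed.
Qed.

Lemma differ_same_inherits D D' : differ_in_refs D D' -> same_inherits D D'.
Proof.
intros HD; assert (HD' := differ_in_refs_sym _ _ HD).
split; split; eauto using differ_dom_inherits, differ_inherits.
Qed.

Lemma differ_same_definitions ms ms' :
  non_references ms = non_references ms' ->
  rearranged (references ms) (references ms') ->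
  differ_in_refs (body ms) (body ms').
Proof.
intros Hn Hr.
(* Each definition is paired with itself. *)
apply differ_body with (map (fun x => (x, x)) (non_references ms)); auto.
- now rewrite map_map, map_id.
- now rewrite map_map, map_id.
- intros x x' Hx; apply in_map_iff in Hx as (? & [= <- <-] & _); constructor.
- intros x x' y y' Hx Hy.
  apply in_map_iff in Hx as (? & [= <- <-] & _).
  apply in_map_iff in Hy as (? & [= <- <-] & _); reflexivity.
Qed.

(** * Replacing the body of a single mixin *)

(** [node_at] extends paths at the end, whereas [replace] recurses from the front; this turns the
    one into the other. *)
Lemma node_at_head D p n :
  node_at D p n ->
  match p with
  | [] => n = D
  | l :: q => exists m, unique (defines D l) m /\ node_at m q n
  end.
Proof.
induction 1 as [|[|l0 q] l n m _ IH Hu]; cbn; auto.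
- subst n; eauto using node_at_root.
- destruct IH as (m0 & Hm0 & Hq); exists m0; split; auto.
  exact (node_at_child _ _ _ _ _ Hq Hu).
Qed.

(* [replace (l :: q) b (body ms)] is convertible to
   [body (map (map_def l (replace q b)) ms)]. *)
Definition map_def (l : label) (f : node -> node) (x : node) : node :=
  match kv x with
  | Some (l', m) => if String.eqb l' l then def l (f m) else x
  | None => x
  end.

Lemma map_def_cases l f x :
  (exists m, x = def l m /\ map_def l f x = def l (f m)) \/
  ((forall m, x <> def l m) /\ map_def l f x = x).
Proof.
unfold map_def; destruct (kv x) as [[l' m]|] eqn:E.
- apply kv_def in E; subst x; destruct (String.eqb_spec l' l) as [->|Hl].
  + left; eauto.
  + right; split; auto; intros m' [= H _]; auto.
- right; split; auto; intros m ->; discriminate.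
Qed.

Lemma is_reference_map_def l f x : is_reference (map_def l f x) = is_reference x.
Proof. now destruct (map_def_cases l f x) as [(m & -> & ->)|[_ ->]]. Qed.

Lemma references_map_def l f ms : references (map (map_def l f) ms) = references ms.
Proof.
unfold references; induction ms as [|x ms IH]; cbn; auto.
rewrite is_reference_map_def, IH; destruct (is_reference x) eqn:E; auto.
destruct (map_def_cases l f x) as [(m & -> & _)|[_ ->]]; [discriminate|auto].
Qed.

Lemma non_references_map_def l f ms :
  non_references (map (map_def l f) ms) = map (map_def l f) (non_references ms).
Proof.
unfold non_references; induction ms as [|x ms IH]; cbn; auto.
rewrite is_reference_map_def, IH; now destruct (is_reference x).
Qed.

Lemma differ_map_def l f m ms :
  unique (defines (body ms) l) m -> differ_in_refs m (f m) ->
  differ_in_refs (body ms) (body (map (map_def l f) ms)).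
Proof.
intros [_ Hu] Hm.
(* All occurrences of a definition of [l] carry the same body [m], so the one hypothesis on [m] and
   [f m] covers them all. *)
assert (Hum : forall m', In (def l m') (non_references ms) -> m' = m).
{ intros m' H; symmetry; apply Hu, defines_body.
  now apply In_def_non_references. }
apply differ_body
  with (map (fun x => (x, map_def l f x)) (non_references ms)).
- rewrite references_map_def; constructor; apply Permutation_refl.
- now rewrite map_map, map_id.
- now rewrite map_map, non_references_map_def.
- intros x x' Hx; apply in_map_iff in Hx as (x0 & [= <- <-] & Hx).
  destruct (map_def_cases l f x0) as [(m' & -> & ->)|[_ ->]]; constructor.
  now rewrite (Hum _ Hx).
- intros x x' y y' Hx Hy.
  apply in_map_iff in Hx as (x0 & [= <- <-] & Hx).
  apply in_map_iff in Hy as (y0 & [= <- <-] & Hy).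
  split; [now intros ->|].
  (* [f] may fail to be injective, but two definitions of [l] both have body [m]; and a rewritten
     definition of [l] never equals a member that does not define [l]. *)
  destruct (map_def_cases l f x0) as [(m1 & -> & ->)|[Hx0 ->]];
    destruct (map_def_cases l f y0) as [(m2 & -> & ->)|[Hy0 ->]]; auto.
  + now rewrite (Hum _ Hx), (Hum _ Hy).
  + intros E; now destruct (Hy0 (f m1)).
  + intros E; now destruct (Hx0 (f m2)).
Qed.

Lemma differ_replace q D b b' :
  node_at D q b -> differ_in_refs b b' -> differ_in_refs D (replace q b' D).
Proof.
revert D; induction q as [|l q IH]; intros D Hb Hd; apply node_at_head in Hb.
- now subst D.
- destruct Hb as (m & Hu & Hm).
  destruct (defines_is_body _ _ _ (proj1 Hu)) as (ms & ->).
  exact (differ_map_def l (replace q b') m ms Hu (IH _ Hm Hd)).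
Qed.

Theorem lemmaB2 :
  (forall D D' : node, differ_in_refs D D' -> same_semantics D D') /\
  (forall (D : node) (q p1 p2 : path) (ms ms' : list node),
      node_at D q (body ms) ->
      named_in_common_scope D q [p1; p2] ->
      non_references ms = non_references ms' ->
      references ms = [ref p1; ref p2] ->
      references ms' = [ref p2; ref p1] ->
      same_inherits D (replace q (body ms') D) /\
      same_semantics D (replace q (body ms') D)) /\
  (forall (D : node) (q p1 : path) (ms ms' : list node),
      node_at D q (body ms) ->
      named_in_common_scope D q [p1] ->
      non_references ms = non_references ms' ->
      references ms = [ref p1; ref p1] ->
      references ms' = [ref p1] ->
      same_inherits D (replace q (body ms') D) /\
      same_semantics D (replace q (body ms') D)).
Proof.
(* Swapping two references and dropping a repeated one are both instances of rearranging the
   references of the mixin at [q]. *)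
assert (Hrep : forall D q ms ms',
  node_at D q (body ms) -> non_references ms = non_references ms' ->
  rearranged (references ms) (references ms') ->
  same_inherits D (replace q (body ms') D) /\
  same_semantics D (replace q (body ms') D)).
{ intros D q ms ms' Hq Hn Hr.
  assert (H : same_inherits D (replace q (body ms') D))
    by eauto using differ_same_inherits, differ_replace, differ_same_definitions.
  split; auto using same_inherits_semantics. }
split; [|split].
- intros D D' H; now apply same_inherits_semantics, differ_same_inherits.
- intros D q p1 p2 ms ms' Hq _ Hn Hr Hr'; apply Hrep with ms; auto.
  (* The first [constructor] is [rearranged_perm], the second the transposition of the two heads. *)
  rewrite Hr, Hr'; constructor; constructor.
- intros D q p1 ms ms' Hq _ Hn Hr Hr'; apply Hrep with ms; auto.
  rewrite Hr, Hr'; apply rearranged_dedup; now left.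
Qed.
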